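(* Let $\varphi=\{\varphi_n\}_{n\in\mathbb{N}}$ and $\psi=\{\psi_n\}_{n\in\mathbb{N}}$ be Bessel sequences of $\mathcal{H}$ with cross Gram operator $G_{\varphi,\psi}$, and let $m=\{m_n\}_{n\in\mathbb{N}}\in\ell^\infty(\mathbb{N})$. Let $M_m$ be the multiplication operator by $m$ on $\ell^2(\mathbb{N})$, and let $M_{m,\varphi,\psi}$ be the Bessel multiplier of $\varphi,\psi$ with symbol $m$. Then $M_{m,\varphi,\psi}$ (on $\mathcal{H}$) and $M_mG_{\varphi,\psi}$ (on $\ell^2(\mathbb{N})$) have the same spectral radius: $$r(M_{m,\varphi,\psi})=r(M_mG_{\varphi,\psi}).$$ In particular, the following bound holds: $$r(M_{m,\varphi,\psi})\leq \Big(\sup_{n\in\mathbb{N}}|m_n|\Big)\,\|G_{\varphi,\psi}\|.$$ Therefore, the spectrum $\sigma(M_{m,\varphi,\psi})$ is contained in the closed disk of the complex plane centered at the origin with radius $\big(\sup_{n}|m_n|\big)\,\|G_{\varphi,\psi}\|$.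
   Context: $\mathcal{H}$ is a separable complex Hilbert space with inner product $\langle\cdot,\cdot\rangle$ (linear in the first argument) and norm $\|\cdot\|$. $\ell^2(\mathbb{N})$ and $\ell^\infty(\mathbb{N})$ are the spaces of square summable and bounded complex sequences indexed by $\mathbb{N}$. A sequence $\varphi=\{\varphi_n\}_{n\in\mathbb{N}}$ in $\mathcal{H}$ is a Bessel sequence if there is $B_\varphi>0$ with $\sum_{n\in\mathbb{N}}|\langle f,\varphi_n\rangle|^2\leq B_\varphi\|f\|^2$ for all $f\in\mathcal{H}$. For a Bessel sequence $\varphi$, the analysis operator is the bounded operator $C_\varphi:\mathcal{H}\to\ell^2(\mathbb{N})$, $C_\varphi f=\{\langle f,\varphi_n\rangle\}_{n}$, and the synthesis operator is the bounded operator $D_\varphi:\ell^2(\mathbb{N})\to\mathcal{H}$, $D_\varphi\{c_n\}=\sum_{n}c_n\varphi_n$. The cross Gram operator of Bessel sequences $\varphi,\psi$ is the bounded operator $G_{\varphi,\psi}=C_\psi D_\varphi:\ell^2(\mathbb{N})\to\ell^2(\mathbb{N})$, i.e. $G_{\varphi,\psi}\{c_n\}=\{d_k\}$ with $d_k=\sum_{n}c_n\langle\varphi_n,\psi_k\rangle$; $\|G_{\varphi,\psi}\|$ is its operator norm. For $m\in\ell^\infty(\mathbb{N})$, the multiplication operator $M_m$ on $\ell^2(\mathbb{N})$ is $M_m\{c_n\}=\{m_nc_n\}$. The Bessel multiplier of $\varphi,\psi$ with symbol $m$ is the bounded operator on $\mathcal{H}$ given by $M_{m,\varphi,\psi}f=\sum_{n\in\mathbb{N}}m_n\langle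 f,\psi_n\rangle\varphi_n$, $f\in\mathcal{H}$. For a bounded operator $T$, $\sigma(T)$ denotes its spectrum and $r(T)=\sup\{|\lambda|:\lambda\in\sigma(T)\}$ its spectral radius. *)

(* Defs.v *)
From HB Require Import structures.
From mathcomp Require Import all_boot all_order all_algebra.
From mathcomp Require Import complex ring lra.
From mathcomp Require Import all_classical all_reals all_analysis.

Set Implicit Arguments.
Unset Strict Implicit.
Unset Printing Implicit Defensive.
Import Order.TTheory GRing.Theory Num.Theory.
Import numFieldNormedType.Exports.
Local Open Scope classical_set_scope.
Local Open Scope complex_scope.
Local Open Scope ring_scope.

Notation normc := ComplexField.Normc.normc.
Notation conjC := Num.Def.conjC.

(* The norm of a normed space over [R[i]] takes its values in [R[i]]; [rnorm]
   is the same nonnegative number seen in [R]. *)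
Definition rnorm (R : realType) (V : normedModType R[i]) (x : V) : R :=
  complex.Re `|x|.

Section ell2.
Context {R : realType}.
Implicit Types (c : nat -> R[i]).

(* The sum of a series of nonnegative terms always exists in [\bar R]. *)
Definition sqsum c : \bar R := (\sum_(0 <= n <oo) (normc (c n) ^+ 2)%:E)%E.

Definition ell2_pred : {pred nat -> R[i]} := fun c => `[< (sqsum c < +oo)%E >].

Lemma normc_ge0 (z : R[i]) : 0 <= normc z.
Proof. by case: z => a b /=; exact: sqrtr_ge0. Qed.

Lemma sqsum_ge0 c : (0 <= sqsum c)%E.
Proof. by apply: nneseries_ge0 => n _ _; rewrite lee_fin sqr_ge0. Qed.

Lemma ell2_predP c : reflect (sqsum c < +oo)%E (c \in ell2_pred).
Proof. exact: asboolP. Qed.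

Lemma ell2_sqsum_fin c : c \in ell2_pred -> sqsum c \is a fin_num.
Proof. by move=> /ell2_predP cfin; rewrite ge0_fin_numE// sqsum_ge0. Qed.

Lemma sqsum0 : sqsum 0 = 0%E.
Proof.
by apply: eseries0 => n _ _; rewrite ComplexField.Normc.normc0 expr0n.
Qed.

Lemma sqsumZ (a : R[i]) c : sqsum (a *: c) = ((normc a ^+ 2)%:E * sqsum c)%E.
Proof.
rewrite /sqsum -nneseriesZl; last by move=> n _; rewrite lee_fin sqr_ge0.
by apply: eq_eseriesr => n _; rewrite ComplexField.Normc.normcM exprMn EFinM.
Qed.

Lemma sqsumD_le (p q : R) c d : 0 < p -> 0 < q -> p * q = 1 ->
  (sqsum (c + d)%R <=
    (1 + p)%:E * sqsum c + (1 + q)%:E * sqsum d)%E.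
Proof.
move=> p0 q0 pq; have p1 : 0 <= 1 + p by lra.
have q1 : 0 <= 1 + q by lra.
rewrite /sqsum -!nneseriesZl; try by move=> n _; rewrite lee_fin sqr_ge0.
rewrite -nneseriesD;
  try by move=> n _ _; rewrite -EFinM lee_fin mulr_ge0 ?sqr_ge0.
apply: lee_nneseries => [n _ _|n _]; first by rewrite lee_fin sqr_ge0.
rewrite -!EFinM -EFinD lee_fin.
set x := normc (c n); set y := normc (d n).
have x0 : 0 <= x := normc_ge0 _.
have y0 : 0 <= y := normc_ge0 _.
have : normc ((c + d) n) ^+ 2 <= (x + y) ^+ 2.
  by rewrite ler_sqr ?nnegrE ?normc_ge0 ?addr_ge0// le_normcD.
move=> /le_trans; apply.
have := mulr_ge0 (ltW q0) (sqr_ge0 (p * x - y)).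
have -> : q * (p * x - y) ^+ 2
  = (p * q) * p * x ^+ 2 - 2 * (p * q) * (x * y) + q * y ^+ 2 by ring.
rewrite pq; nra.
Qed.

Fact ell2_submod_closed : subsemimod_closed ell2_pred.
Proof.
split; first split.
- by apply/ell2_predP; rewrite sqsum0 ltry.
- move=> c d /ell2_sqsum_fin cfin /ell2_sqsum_fin dfin; apply/ell2_predP.
  apply: le_lt_trans (@sqsumD_le 1 1 _ _ ltr01 ltr01 (mulr1 1)) _.
  by rewrite -(fineK cfin) -(fineK dfin) -!EFinM -EFinD ltry.
- move=> a c /ell2_sqsum_fin cfin; apply/ell2_predP.
  by rewrite sqsumZ -(fineK cfin) -EFinM ltry.
Qed.

HB.instance Definition _ :=
  GRing.isSubmodClosed.Build R[i] (nat -> R[i]) ell2_pred ell2_submod_closed.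

End ell2.

Record ell2 (R : realType) := Ell2 {
  ell2val :> nat -> R[i] ;
  ell2valP : ell2val \in ell2_pred }.

Section ell2_normed.
Context {R : realType}.

HB.instance Definition _ := [isSub for @ell2val R].
HB.instance Definition _ := [Choice of ell2 R by <:].
HB.instance Definition _ := [SubChoice_isSubLmodule of ell2 R by <:].

Definition ell2norm (c : ell2 R) : R := Num.sqrt (fine (sqsum c)).

Lemma ell2norm_ge0 c : 0 <= ell2norm c.
Proof. exact: sqrtr_ge0. Qed.

Lemma sqsumE (c : ell2 R) : sqsum c = (ell2norm c ^+ 2)%:E.
Proof.
rewrite sqr_sqrtr ?fine_ge0 ?sqsum_ge0// fineK//.
exact/ell2_sqsum_fin/ell2valP.
Qed.

Lemma ell2norm_eq0 c : ell2norm c = 0 -> c = 0.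
Proof.
move=> c0; have := sqsumE c; rewrite c0 expr0n => s0.
apply: val_inj; apply/funext => n /=; apply: ComplexField.Normc.eq0_normc.
apply/eqP; rewrite -sqrf_eq0 eq_le sqr_ge0 andbT -lee_fin -s0.
rewrite /sqsum (@nneseriesD1 _ _ n)//; last by move=> k _; rewrite lee_fin sqr_ge0.
by rewrite leeDl// nneseries_ge0// => k _ _; rewrite lee_fin sqr_ge0.
Qed.

Lemma ell2normZ (a : R[i]) c : ell2norm (a *: c) = normc a * ell2norm c.
Proof.
rewrite /ell2norm sqsumZ fineM ?ell2_sqsum_fin ?ell2valP//=.
by rewrite sqrtrM ?sqr_ge0// sqrtr_sqr ger0_norm ?normc_ge0.
Qed.

Lemma ell2normD c d : ell2norm (c + d) <= ell2norm c + ell2norm d.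
Proof.
have := ell2norm_ge0 c; rewrite le_eqVlt => /orP[/eqP/esym/[dup] c0|c0].
  by move=> /ell2norm_eq0 ->; rewrite add0r lerDr ell2norm_ge0.
have := ell2norm_ge0 d; rewrite le_eqVlt => /orP[/eqP/esym/[dup] d0|d0].
  by move=> /ell2norm_eq0 ->; rewrite addr0 lerDl ell2norm_ge0.
rewrite -ler_sqr ?nnegrE ?addr_ge0 ?ell2norm_ge0// -lee_fin -sqsumE.
set x := ell2norm c in c0 *; set y := ell2norm d in d0 *.
have yx : 0 < y / x by rewrite divr_gt0.
have xy : 0 < x / y by rewrite divr_gt0.
have xyE : (y / x) * (x / y) = 1 by field; rewrite !gt_eqF.
apply: le_trans (sqsumD_le (ell2val c) (ell2val d) yx xy xyE) _.
rewrite !sqsumE -/x -/y -!EFinM -EFinD lee_fin le_eqVlt; apply/orP; left.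
by apply/eqP; field; rewrite !gt_eqF.
Qed.

Let norm (c : ell2 R) : R[i] := (ell2norm c)%:C.

Fact ell2_normD c d : norm (c + d) <= norm c + norm d.
Proof. by rewrite /norm -rmorphD lecR ell2normD. Qed.

Fact ell2_normZ (a : R[i]) c : norm (a *: c) = `|a| * norm c.
Proof. by rewrite /norm ell2normZ rmorphM. Qed.

Fact ell2_norm0_eq0 c : norm c = 0 -> c = 0.
Proof. by case=> /ell2norm_eq0. Qed.

HB.instance Definition _ :=
  Lmodule_isNormed.Build R[i] (ell2 R) ell2_normD ell2_normZ ell2_norm0_eq0.

End ell2_normed.

Section operators.
Context {R : realType}.

(* [sup] is the supremum in [R]; the sets below are bounded whenever the
   operator is, and [sup set0 = 0] gives spectral radius 0 on the zero space,
   where the spectrum is empty. *)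
Definition opnorm (V W : normedModType R[i]) (T : V -> W) : R :=
  sup [set rnorm (T x) | x in [set x | rnorm x <= 1]].

(* [{linear V -> V}] with [continuous] is a bounded operator, see
   [linear_bounded_continuous]. *)
Definition spectrum (V : normedModType R[i]) (T : V -> V) : set R[i] :=
  [set l | ~ exists S : {linear V -> V},
     [/\ continuous S,
         forall x, S (l *: x - T x) = x &
         forall x, l *: S x - T (S x) = x]].

Definition spectral_radius (V : normedModType R[i]) (T : V -> V) : R :=
  sup [set normc l | l in spectrum T].

Definition linfty (m : nat -> R[i]) : Prop := bounded_fun (m : nat -> R[i]^o).

Definition linfty_norm (m : nat -> R[i]) : R := sup (range (fun n => normc (m n))).

Fact mulop_subproof (m : nat -> R[i]) (mB : linfty m) (c : ell2 R) :
  (fun n => m n * c n) \in ell2_pred.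
Proof.
have /pinfty_ex_gt0[K K0 mK] := mB.
have mK' n : normc (m n) <= complex.Re K.
  have mnK : (`|m n| : R[i]) <= K by exact: mK.
  by move: mnK; rewrite lecE => /andP[_].
have /ell2_sqsum_fin cfin := ell2valP c; apply/ell2_predP.
apply: (@le_lt_trans _ _ ((complex.Re K ^+ 2)%:E * sqsum c)%E); last first.
  by rewrite -(fineK cfin) -EFinM ltry.
rewrite /sqsum -nneseriesZl; last by move=> n _; rewrite lee_fin sqr_ge0.
apply: lee_nneseries => n _; first by rewrite lee_fin sqr_ge0.
rewrite -EFinM lee_fin ComplexField.Normc.normcM exprMn ler_wpM2r ?sqr_ge0//.
by rewrite ler_sqr ?nnegrE ?normc_ge0// (le_trans _ (mK' n)) ?normc_ge0.
Qed.

Definition mulop (m : nat -> R[i]) (mB : linfty m) (c : ell2 R) : ell2 R :=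
  Ell2 (mulop_subproof mB c).

End operators.

Section frames.
Context {R : realType} {H : completeNormedModType R[i]}.
Variable ip : {dot H for conjC}.
Implicit Types (phi psi : nat -> H) (m : nat -> R[i]).

Definition bessel phi := exists2 B : R, 0 < B &
  forall f : H, (\sum_(0 <= n <oo) (normc (ip f (phi n)) ^+ 2)%:E
                 <= (B * rnorm f ^+ 2)%:E)%E.

Fact analysis_subproof psi (psiB : bessel psi) (f : H) :
  (fun n => ip f (psi n)) \in ell2_pred.
Proof.
apply/ell2_predP; have [B _ /(_ f)] := psiB.
by move=> /le_lt_trans; apply; rewrite ltry.
Qed.

Definition analysis psi (psiB : bessel psi) (f : H) : ell2 R :=
  Ell2 (analysis_subproof psiB f).

Definition synthesis phi (c : ell2 R) : H :=
  limn (series (fun n => c n *: phi n)).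

Definition cross_gram phi psi (psiB : bessel psi) : ell2 R -> ell2 R :=
  analysis psiB \o synthesis phi.

Definition bessel_multiplier m phi psi (f : H) : H :=
  limn (series (fun n => (m n * ip f (psi n)) *: phi n)).

End frames.

Definition separable (T : topologicalType) :=
  exists2 D : set T, countable D & dense D.

(* Main.v *)
(* With [A = M_m C_psi] and [D = D_phi], the multiplier is [D A] and [M_m G] is
   [A D]; two such products have the same spectrum up to [0].  For
   [|l| > (sup |m|) ||G||] the Neumann series of [D A] converges because
   [(D A)^(n+1) = D (A D)^n A] and [||A D|| <= (sup |m|) ||G||]. *)
From HB Require Import structures.
Require Import Defs.
From mathcomp Require Import all_boot all_order all_algebra.
From mathcomp Require Import complex.
From mathcomp Require Import all_classical all_reals all_analysis.
From mathcomp Require Import ring lra.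
Import Order.TTheory GRing.Theory Num.Theory.
Import numFieldNormedType.Exports.
Local Open Scope classical_set_scope.
Local Open Scope complex_scope.
Local Open Scope ring_scope.

(** * Real-valued norms, convergence and bounded operators *)

Section rnorm_theory.
Set Implicit Arguments.
Unset Strict Implicit.
Context {R : realType}.
Implicit Types V W : normedModType R[i].

Lemma normcE (z : R[i]) : `|z| = (normc z)%:C.
Proof. by []. Qed.

(** In [R[i]], [0 <= z] forces the imaginary part of [z] to vanish, so taking the real part of a
    norm loses nothing. *)
Lemma rnormE V (x : V) : `|x| = (rnorm x)%:C.
Proof.
have : 0 <= `|x| by exact: normr_ge0.
by rewrite /rnorm; case: (`|x|) => a b; rewrite lecE /= => /andP[/eqP -> _].
Qed.

Lemma rnorm_ge0 V (x : V) : 0 <= rnorm x.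
Proof. by rewrite -lecR -rnormE; exact: normr_ge0. Qed.

Lemma rnormD V (x y : V) : rnorm (x + y) <= rnorm x + rnorm y.
Proof. by rewrite -lecR rmorphD /= -!rnormE ler_normD. Qed.

Lemma rnormZ V (a : R[i]) (x : V) : rnorm (a *: x) = normc a * rnorm x.
Proof. by apply: complexI; rewrite rmorphM /= -!rnormE normrZ. Qed.

Lemma rnorm_distC V (x y : V) : rnorm (x - y) = rnorm (y - x).
Proof. by apply: complexI; rewrite -!rnormE distrC. Qed.

Lemma rnorm0 V : rnorm (0 : V) = 0.
Proof. by apply: complexI; rewrite -rnormE normr0. Qed.

Lemma rnorm_eq0 V (x : V) : rnorm x = 0 -> x = 0.
Proof. by move=> x0; apply/normr0_eq0; rewrite rnormE x0. Qed.

Lemma rnorm_sum V (I : Type) (r : seq I) (P : pred I) (F : I -> V) :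
  rnorm (\sum_(i <- r | P i) F i) <= \sum_(i <- r | P i) rnorm (F i).
Proof.
elim/big_ind2 : _ => //; first by rewrite rnorm0.
by move=> x a y b xa yb; rewrite (le_trans (rnormD _ _))// lerD.
Qed.

Lemma cvg_rnormP V (u : nat -> V) (l : V) :
  u @ \oo --> l <->
  forall e : R, 0 < e -> \forall n \near \oo, rnorm (l - u n) < e.
Proof.
split=> [/cvgrPdist_lt ul e e0|ul].
  have /ul : (0 : R[i]) < e%:C by rewrite ltcR.
  by apply: filterS => n; rewrite rnormE ltcR.
(* A positive radius in [R[i]] is real, so real radii suffice. *)
apply/cvgrPdist_lt => -[e e'].
rewrite ltcE /= => /andP[/eqP -> e0].
by apply: filterS (ul _ e0) => n; rewrite rnormE ltcR.
Qed.

Lemma rnorm_lim_le V (u : nat -> V) (l : V) (K : R) :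
  u @ \oo --> l -> (forall n, rnorm (u n) <= K) -> rnorm l <= K.
Proof.
move=> /cvg_rnormP ul uK; apply/ler_addgt0Pr => e e0.
have [N _ /(_ N (leqnn N)) lN] := ul e e0.
have -> : l = u N + (l - u N) by rewrite addrC subrK.
by rewrite (le_trans (rnormD _ _))// lerD// ltW.
Qed.

(** Serves both the Neumann series and the synthesis series: the modulus [c p] does not depend on
    [n], so a late term [u N] is the centre of a small ball containing all later terms. *)
Lemma cauchy_tail_cvgn (V : completeNormedModType R[i]) (u : nat -> V)
    (c : nat -> R) :
  c @ \oo --> 0 ->
  (forall p n, (p <= n)%N -> rnorm (u n - u p) <= c p) -> cvgn u.
Proof.
move=> c0 uc; apply: cauchy_cvg; apply: cauchy_exP => -[e e'].
rewrite ltcE /= => /andP[/eqP -> e0].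
have /cvgrPdist_lt/(_ e e0)[N _ cN] := c0.
exists (u N), N => // n Nn /=.
rewrite -ball_normE /= rnormE ltcR rnorm_distC.
apply: le_lt_trans (uc _ _ Nn) _.
by have := cN N (leqnn N); rewrite sub0r normrN => /(le_lt_trans (ler_norm _)).
Qed.

(** A predicate on bare functions, which suits composites, iterates and pointwise limits;
    [bounded_op_continuous] and [continuous_bounded_op] translate to and from the continuous linear
    maps of [spectrum]. *)
Definition bounded_op V W (f : V -> W) :=
  linear f /\ exists K : R, forall x, rnorm (f x) <= K * rnorm x.

Lemma bounded_op_ge0 {V W} {f : V -> W} : bounded_op f ->
  exists2 K : R, 0 <= K & forall x, rnorm (f x) <= K * rnorm x.
Proof.
move=> [_ [K fK]]; exists `|K| => // x.
by rewrite (le_trans (fK x))// ler_wpM2r ?rnorm_ge0// ler_norm.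
Qed.

Definition lin_of V W (f : V -> W) (fl : linear f) : {linear V -> W} :=
  HB.pack f (GRing.isLinear.Build R[i] V W *:%R f fl).

Lemma bounded_op_continuous V W (f : V -> W) : bounded_op f ->
  exists2 g : {linear V -> W}, continuous g & g = f :> (V -> W).
Proof.
move=> /[dup] /bounded_op_ge0 [K K0 fK] [fl _].
exists (lin_of fl) => //; apply/linear_bounded_continuous.
apply/linear_boundedP; exists K%:C; split; first by rewrite ger0_real ?lecR.
move=> r Kr x; apply: le_trans (_ : K%:C * `|x| <= _).
  by rewrite !rnormE -rmorphM lecR fK.
by rewrite ler_wpM2r// ltW.
Qed.

Lemma continuous_bounded_op V W (f : {linear V -> W}) :
  continuous f -> bounded_op f.
Proof.
move=> fc; split; first exact: linearP.
have /linear_boundedP/pinfty_ex_gt0 [[K K'] K0 fK] :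
  bounded_near f (nbhs 0) by apply/linear_bounded_continuous.
exists K => x; move: K0; rewrite ltcE /= => /andP[/eqP K'0 _].
by rewrite -lecR rmorphM /= -!rnormE; have := fK x; rewrite K'0.
Qed.

Lemma bounded_opD V W (f : V -> W) : bounded_op f -> {morph f : x y / x + y}.
Proof. by move=> [fl _]; exact: (linearD (lin_of fl)). Qed.

Lemma bounded_opB V W (f : V -> W) : bounded_op f -> {morph f : x y / x - y}.
Proof. by move=> [fl _]; exact: (linearB (lin_of fl)). Qed.

Lemma bounded_opZ V W (f : V -> W) : bounded_op f ->
  forall a, {morph f : x / a *: x}.
Proof. by move=> [fl _]; exact: (linearZZ (lin_of fl)). Qed.

Lemma bounded_op0 V W (f : V -> W) : bounded_op f -> f 0 = 0.
Proof. by move=> [fl _]; exact: (linear0 (lin_of fl)). Qed.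

Lemma bounded_op_sum V W (f : V -> W) : bounded_op f ->
  forall (I : Type) (r : seq I) (P : pred I) (F : I -> V),
  f (\sum_(i <- r | P i) F i) = \sum_(i <- r | P i) f (F i).
Proof. by move=> [fl _]; exact: (linear_sum (lin_of fl)). Qed.

Lemma bounded_op_comp V W (X : normedModType R[i]) (f : V -> W) (g : W -> X) :
  bounded_op f -> bounded_op g -> bounded_op (g \o f).
Proof.
move=> /[dup] /bounded_op_ge0 [K K0 fK] [fl _].
move=> /[dup] /bounded_op_ge0 [L L0 gL] [gl _].
split; first by move=> a x y /=; rewrite fl gl.
exists (L * K) => x; rewrite (le_trans (gL _))// -mulrA ler_wpM2l//.
Qed.

Lemma bounded_op_cvg V W (f : V -> W) (u : nat -> V) (l : V) :
  bounded_op f -> u @ \oo --> l -> (f \o u) @ \oo --> f l.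
Proof.
by move=> /bounded_op_continuous[g gc <-] ul; apply: cvg_comp ul (gc _).
Qed.

(** Boundedness makes the [sup] over the closed unit ball a genuine supremum; homogeneity carries
    the bound from unit vectors to every nonzero [x]. *)
Lemma le_opnorm V W (f : V -> W) : bounded_op f ->
  0 <= opnorm f /\ forall x, rnorm (f x) <= opnorm f * rnorm x.
Proof.
move=> fb; have [K K0 fK] := bounded_op_ge0 fb.
have fs : has_sup [set rnorm (f x) | x in [set x | rnorm x <= 1]].
  split; first by exists (rnorm (f 0)), 0 => //=; rewrite rnorm0.
  exists K => _ [x /= x1 <-]; apply: le_trans (fK x) _.
  by rewrite ler_piMr.
have fle x : rnorm x <= 1 -> rnorm (f x) <= opnorm f.
  by move=> x1; apply: ub_le_sup; [case: fs|exists x].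
split; first by rewrite (le_trans (rnorm_ge0 (f 0)))// fle// rnorm0.
move=> x; have := rnorm_ge0 x; rewrite le_eqVlt => /orP[/eqP x0|x0].
  by rewrite -x0 mulr0 (@rnorm_eq0 _ x)// (bounded_op0 fb) rnorm0.
have xn : normc ((rnorm x)^-1%:C) = (rnorm x)^-1.
  by apply: complexI; rewrite -normcE ger0_norm// lecR invr_ge0 ltW.
have := fle ((rnorm x)^-1%:C *: x).
rewrite (bounded_opZ fb) !rnormZ xn mulVf ?gt_eqF// => /(_ (lexx _)).
by rewrite mulrC ler_pdivrMr.
Qed.

End rnorm_theory.

(** * Spectra of products and the Neumann series *)

Section spectral_theory.
Set Implicit Arguments.
Unset Strict Implicit.
Context {R : realType}.
Implicit Types V W : normedModType R[i].

Lemma spectrumN V (T : V -> V) (l : R[i]) (S : V -> V) :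
  bounded_op S -> (forall x, S (l *: x - T x) = x) ->
  (forall x, l *: S x - T (S x) = x) -> ~ spectrum T l.
Proof.
move=> /bounded_op_continuous [g gc gS] ST TS; apply; exists g.
by split=> // x; rewrite gS; [exact: ST|exact: TS].
Qed.

(* [l - D A] is inverted by [l^-1 (1 + D S A)], where [S] inverts [l - A D]. *)
Lemma spectrum_comp_swap V W (A : V -> W) (D : W -> V) (l : R[i]) :
  bounded_op A -> bounded_op D -> l != 0 ->
  spectrum (D \o A) l -> spectrum (A \o D) l.
Proof.
move=> Ab Db l0 sDA [S [/continuous_bounded_op Sb SK KS]].
have DSAb : bounded_op (D \o (S \o A)).
  by apply: bounded_op_comp => //; exact: bounded_op_comp.
move: sDA; apply: (@spectrumN _ _ _ (fun x => l^-1 *: (x + D (S (A x))))).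
- have [K DSAK] := DSAb.2; split.
    move=> a x y; have /= -> := DSAb.1 a x y.
    by rewrite !scalerDr !scalerA [in a * _]mulrC addrACA.
  exists (normc l^-1 * (1 + K)) => x; rewrite rnormZ -mulrA.
  rewrite ler_wpM2l ?normc_ge0// mulrDl mul1r.
  by rewrite (le_trans (rnormD _ _))// lerD2l; exact: DSAK.
(* [S (l *: A x - A (D (A x)))] is [A x], so the two copies of [D (A x)] cancel. *)
- move=> x /=; rewrite (bounded_opB Ab) (bounded_opZ Ab).
  by rewrite SK subrK scalerA mulVf// scale1r.
- move=> x /=; rewrite scalerA mulfV// scale1r.
  rewrite (bounded_opZ Ab) (bounded_opZ Db) (bounded_opD Ab) (bounded_opD Db).
  (* [D] applied to the right-inverse identity at [A x] turns [D (A x) + D (A (D (S (A x))))] into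
     [l *: D (S (A x))]. *)
  have := congr1 D (KS (A x)).
  rewrite /= (bounded_opB Db) (bounded_opZ Db) => /eqP.
  rewrite subr_eq => /eqP DE.
  by rewrite -DE scalerA mulVf// scale1r addrK.
Qed.

(* [sup] sees no difference even when [A] is empty or unbounded, since it is
   then [0] by convention. *)
Lemma sup_setU0 (A : set R) : (forall x, A x -> 0 <= x) ->
  sup (A `|` [set 0]) = sup A.
Proof.
move=> A0; have [->|/set0P[a Aa]] := eqVneq A set0.
  by rewrite set0U sup1 sup0.
have [[u Au]|nA] := pselect (has_ubound A); last first.
  rewrite !sup_out// => -[_ [u Au]]; apply: nA; exists u => // x Ax.
  by apply: Au; left.
apply/eqP; rewrite eq_le; apply/andP; split.
  apply: sup_le_ub; first by exists 0; right.
  have Aub x : A x -> x <= sup A by apply: ub_le_sup; exists u.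
  by move=> x [/Aub//|->]; exact: le_trans (A0 _ Aa) (Aub _ Aa).
apply: sup_le_ub; first by exists a.
move=> x Ax; apply: ub_le_sup; last by left.
exists u => y [/Au//|->]; exact: le_trans (A0 _ Aa) (Au _ Aa).
Qed.

(** The spectra of [D A] and [A D] may differ at [0]; adjoining [0] to both sets of moduli makes
    them equal and changes neither [sup]. *)
Lemma sup_eq_off0 (A B : set R) :
  (forall x, A x -> 0 <= x) -> (forall x, B x -> 0 <= x) ->
  (forall x, x != 0 -> A x <-> B x) -> sup A = sup B.
Proof.
move=> A0 B0 AB; rewrite -(sup_setU0 A0) -(sup_setU0 B0); congr sup.
apply/seteqP; split=> x; have [->|x0] := eqVneq x 0; try by right.
  by move=> [/AB-/(_ x0)|]; [left|right].
by move=> [/AB-/(_ x0)|]; [left|right].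
Qed.

Lemma spectral_radius_comp V W (A : V -> W) (D : W -> V) :
  bounded_op A -> bounded_op D ->
  spectral_radius (D \o A) = spectral_radius (A \o D).
Proof.
move=> Ab Db; apply: sup_eq_off0.
- by move=> _ [l _ <-]; exact: normc_ge0.
- by move=> _ [l _ <-]; exact: normc_ge0.
- move=> x x0; split=> -[l sl lx]; exists l => //.
    by apply: spectrum_comp_swap sl => //; apply: contraNneq x0 => l0;
      rewrite -lx l0 ComplexField.Normc.normc0.
  by apply: spectrum_comp_swap sl => //; apply: contraNneq x0 => l0;
    rewrite -lx l0 ComplexField.Normc.normc0.
Qed.

(** The inverse of [l - T] is the sum of [l^-1 ^+ k.+1 *: iter k T x], dominated by a geometric
    series of ratio [q / normc l]. The bound is on iterates because the norm of [D A] itself may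
    exceed [q]. *)
Lemma neumann_notin_spectrum (V : completeNormedModType R[i]) (T : V -> V)
    (l : R[i]) (C q : R) :
  bounded_op T -> 0 <= q -> q < normc l ->
  (forall n x, rnorm (iter n T x) <= C * q ^+ n * rnorm x) -> ~ spectrum T l.
Proof.
move=> Tb q0 ql TC; set p := normc l.
have p0 : 0 < p by apply: le_lt_trans ql.
have l0 : l != 0.
  by apply: contraTneq p0 => l0; rewrite /p l0 ComplexField.Normc.normc0 ltxx.
pose r := p^-1 * q.
have r0 : 0 <= r by rewrite mulr_ge0// invr_ge0 ltW.
have r1 : r < 1 by rewrite /r mulrC ltr_pdivrMr// mul1r.
have normcVX n : normc (l^-1 ^+ n) = p^-1 ^+ n.
  apply: complexI; rewrite -normcE normrX normrV ?unitfE// normcE -/p.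
  by rewrite rmorphXn /= fmorphV.
pose v x k := l^-1 ^+ k.+1 *: iter k T x.
have vle x k : rnorm (v x k) <= p^-1 * C * rnorm x * r ^+ k.
  rewrite rnormZ normcVX exprMn exprS.
  apply: le_trans (_ : p^-1 * p^-1 ^+ k * (C * q ^+ k * rnorm x) <= _).
    by rewrite ler_wpM2l// -exprS exprn_ge0// invr_ge0 ltW.
  by rewrite le_eqVlt; apply/orP; left; apply/eqP; ring.
(* The sign is read off from the bound on iterates at [n = 0]. *)
have C0 (x : V) : 0 <= C * rnorm x.
  by have := TC 0%N x; rewrite expr0 mulr1; apply: le_trans; exact: rnorm_ge0.
pose c (x : V) := p^-1 * C * rnorm x / (1 - r).
(* One estimate with two uses: general [i] gives the Cauchy property, [i = 0] the boundedness of
   [S]. *)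
have sumle (x : V) (i n : nat) : (i <= n)%N ->
    \sum_(i <= k < n) rnorm (v x k) <= c x * r ^+ i.
  move=> ilen; rewrite -[X in \sum_(X <= _ < _) _]add0n big_addn.
  apply: (@le_trans _ _
    (\sum_(0 <= k < n - i) p^-1 * C * rnorm x * r ^+ (k + i))).
    by apply: ler_sum => k _; exact: vle.
  under eq_bigr do rewrite addnC exprD mulrA.
  rewrite -mulr_sumr big_mkord.
  (* The left side equals [1 - r ^+ (n - i)]. *)
  have : (1 - r) * (\sum_(k < n - i) r ^+ k) <= 1.
    rewrite mulrC -[X in _ * X]opprB mulrN mulrC -subrX1 opprB.
    by rewrite gerBl exprn_ge0.
  rewrite -ler_pdivlMl ?subr_gt0// mulr1 => /ler_wpM2l.
  have pCx : 0 <= p^-1 * C * rnorm x * r ^+ i.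
    by rewrite mulr_ge0 ?exprn_ge0// -mulrA mulr_ge0// invr_ge0 ltW.
  move=> /(_ _ pCx) /le_trans; apply.
  by rewrite /c le_eqVlt; apply/orP; left; apply/eqP; ring.
have scvg x : cvgn (series (v x)).
  apply: (@cauchy_tail_cvgn _ _ _ (fun i => c x * r ^+ i)).
    rewrite -(mulr0 (c x)); apply: cvgM; first exact: cvg_cst.
    by apply: cvg_expr; rewrite ger0_norm.
  move=> i n lein; rewrite sub_series lein.
  exact: le_trans (rnorm_sum _ _ _) (sumle _ _ _ lein).
pose S x := limn (series (v x)).
have Scvg x : series (v x) @ \oo --> S x by exact: scvg.
have iterb n : bounded_op (iter n T).
  elim: n => [|n IHn]; last exact: (bounded_op_comp IHn Tb).
  by split=> //; exists 1 => x; rewrite mul1r.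
have Sb : bounded_op S.
  split=> [a x y|].
    apply: (cvg_lim (@norm_hausdorff _ V)).
    have -> : series (v (a *: x + y)) = a \*: series (v x) + series (v y).
      apply/funext => n; rewrite fctE /series /= scaler_sumr -big_split.
      apply: eq_bigr => k _; rewrite /v (bounded_opD (iterb k)).
      by rewrite (bounded_opZ (iterb k)) scalerDr !scalerA mulrC.
    by apply: cvgD => //; exact: cvgZl_tmp.
  exists (p^-1 * C / (1 - r)) => x.
  have -> : p^-1 * C / (1 - r) * rnorm x = c x by rewrite /c; ring.
  apply: rnorm_lim_le (Scvg x) _ => n.
  apply: le_trans (rnorm_sum _ _ _) _.
  by rewrite -[c x]mulr1 -(expr0 r); exact: sumle.
(* The partial sums telescope; [rem] shows that the remainder, of norm at most
   [C * rnorm x * r ^+ n], vanishes in the limit. *)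
have tele x n : l *: series (v x) n - T (series (v x) n) =
    x - l^-1 ^+ n *: iter n T x.
  rewrite /series /= (bounded_op_sum Tb) scaler_sumr -sumrB.
  elim: n => [|n IHn]; first by rewrite big_nil expr0 scale1r subrr.
  rewrite big_nat_recr//= IHn /v (bounded_opZ Tb) scalerA exprS mulrA.
  by rewrite mulfV// mul1r addrA subrK -exprS.
have rem x : (fun n => x - l^-1 ^+ n *: iter n T x) @ \oo --> x.
  rewrite -[X in _ --> X]subr0; apply: cvgB; first exact: cvg_cst.
  apply/cvg_rnormP => e e0.
  have : (fun n => C * rnorm x * r ^+ n) @ \oo --> (0 : R).
    rewrite -(mulr0 (C * rnorm x)); apply: cvgM; first exact: cvg_cst.
    by apply: cvg_expr; rewrite ger0_norm.
  move=> /cvgrPdist_lt/(_ e e0); apply: filterS => n.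
  rewrite sub0r normrN => /(le_lt_trans (ler_norm _)); apply: le_lt_trans.
  rewrite rnorm_distC subr0 rnormZ normcVX.
  apply: le_trans (_ : p^-1 ^+ n * (C * q ^+ n * rnorm x) <= _).
    by rewrite ler_wpM2l// exprn_ge0// invr_ge0 ltW.
  by rewrite exprMn le_eqVlt; apply/orP; left; apply/eqP; ring.
have TS x : l *: S x - T (S x) = x.
  have : (fun n => l *: series (v x) n - T (series (v x) n)) @ \oo
      --> l *: S x - T (S x).
    apply: cvgB; first exact: cvgZl_tmp.
    exact: bounded_op_cvg.
  rewrite (funext (tele x)) => cvS.
  exact: (cvg_unique (@norm_hausdorff _ V) cvS (rem x)).
(* The left inverse follows from the right one once [S] commutes with [T], which holds because each
   partial sum does. *)
apply: (spectrumN Sb) => // x.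
rewrite (bounded_opB Sb) (bounded_opZ Sb) -[RHS]TS; congr (_ - _).
apply: (cvg_lim (@norm_hausdorff _ V)).
have -> : series (v (T x)) = T \o series (v x).
  apply/funext => n; rewrite /series /= (bounded_op_sum Tb).
  by apply: eq_bigr => k _; rewrite /v (bounded_opZ Tb) -iterSr.
exact: bounded_op_cvg.
Qed.

(* Bounding [(D A)^n] through [(A D)^(n - 1)] puts the Neumann series in [V],
   so that completeness of [W] is not needed. *)
Lemma spectrum_comp_le (V : completeNormedModType R[i]) W (A : V -> W)
    (D : W -> V) (q : R) (l : R[i]) :
  bounded_op A -> bounded_op D -> 0 <= q ->
  (forall y, rnorm (A (D y)) <= q * rnorm y) ->
  spectrum (D \o A) l -> normc l <= q.
Proof.
move=> Ab Db q0 ADq sl; rewrite leNgt; apply/negP => ql.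
have [a a0 Aa] := bounded_op_ge0 Ab.
have [d d0 Dd] := bounded_op_ge0 Db.
(* A ratio strictly between [q] and [normc l]: it is positive even when [q = 0], so it may be
   divided by. *)
pose p := (q + normc l) / 2.
have [qp pl] : q < p /\ p < normc l by rewrite /p; split; lra.
have p0 : 0 < p by apply: le_lt_trans qp.
(* In the constant, [1] covers [n = 0], and [d * a / p] covers [n.+1], where the bound
   [d * p ^+ n * a] falls one power of [p] short. *)
apply: (@neumann_notin_spectrum V (D \o A) l (1 + d * a / p) p _ _ pl _ sl).
- exact: bounded_op_comp.
- exact: ltW.
have dap : 0 <= d * a / p by rewrite !mulr_ge0// invr_ge0 ltW.
have ADn n y : rnorm (iter n (A \o D) y) <= p ^+ n * rnorm y.
  elim: n => [|n IHn]; first by rewrite expr0 mul1r.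
  rewrite iterS exprS -mulrA (le_trans (ADq _))// ler_pM ?rnorm_ge0//.
  exact: ltW.
move=> [|n] x.
  by rewrite expr0 mulr1 ler_peMl ?rnorm_ge0// lerDl.
have -> : iter n.+1 (D \o A) x = D (iter n (A \o D) (A x)).
  by elim: n => //= n ->.
apply: le_trans (Dd _) _.
apply: le_trans (_ : d * (p ^+ n * (a * rnorm x)) <= _).
  rewrite ler_wpM2l// (le_trans (ADn _ _))// ler_wpM2l ?Aa// exprn_ge0//.
  exact: ltW.
have -> : d * (p ^+ n * (a * rnorm x)) = d * a / p * p ^+ n.+1 * rnorm x.
  by rewrite exprS; field; rewrite gt_eqF.
by rewrite ler_wpM2r ?rnorm_ge0// ler_wpM2r ?exprn_ge0 ?(ltW p0)// lerDr.
Qed.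

End spectral_theory.

(** * Bessel sequences and the boundedness of synthesis, analysis and multiplication *)

Section bessel_theory.
Set Implicit Arguments.
Unset Strict Implicit.
Context {R : realType}.

(** The right side is the tail from [i]: it is free of [n] and tends to [0] by [sqsum_partial_cvg],
    as a Cauchy modulus must. *)
Lemma sqsum_partial_le (c : ell2 R) (i n : nat) : (i <= n)%N ->
  \sum_(i <= k < n) normc (c k) ^+ 2 <=
  ell2norm c ^+ 2 - \sum_(0 <= k < i) normc (c k) ^+ 2.
Proof.
move=> lein; rewrite lerBrDl -big_cat_nat//= -lee_fin -sqsumE -sumEFin.
by apply: nneseries_lim_ge => k _ _; rewrite lee_fin sqr_ge0.
Qed.

Lemma sqsum_partial_cvg (c : ell2 R) :
  (fun i => \sum_(0 <= k < i) normc (c k) ^+ 2) @ \oo --> ell2norm c ^+ 2.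
Proof.
have : (fun i => (\sum_(0 <= k < i) normc (c k) ^+ 2)%:E) @ \oo -->
    (ell2norm c ^+ 2)%:E.
  rewrite -sqsumE /sqsum.
  under eq_fun do rewrite -sumEFin.
  by apply: is_cvg_nneseries => k _ _; rewrite lee_fin sqr_ge0.
by move=> /fine_cvg.
Qed.

Context {H : completeNormedModType R[i]} (ip : {dot H for conjC})
  (ip_norm : forall f : H, ip f f = `|f| ^+ 2).

Lemma normc_ipC (f g : H) : normc (ip f g) = normc (ip g f).
Proof.
by apply: complexI; rewrite -!normcE hermC /= expr0 mul1r norm_conjC.
Qed.

(* AM-GM on [2 |c_k| |<phi_k, g>|] absorbs the Bessel sum of [g] itself. *)
Lemma bessel_sum_le (phi : nat -> H) (B : R) (c : nat -> R[i]) (i n : nat) :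
  0 < B ->
  (forall f : H, (\sum_(0 <= k <oo) (normc (ip f (phi k)) ^+ 2)%:E
                 <= (B * rnorm f ^+ 2)%:E)%E) ->
  rnorm (\sum_(i <= k < n) c k *: phi k) ^+ 2 <=
    B * \sum_(i <= k < n) normc (c k) ^+ 2.
Proof.
move=> B0 phiB; set g := \sum_(i <= k < n) _.
(* Pair [g] with itself and expand only the first argument. *)
have gle : rnorm g ^+ 2 <=
    \sum_(i <= k < n) normc (c k) * normc (ip g (phi k)).
  have -> : rnorm g ^+ 2 = normc (ip g g).
    apply: complexI; rewrite -normcE ip_norm rmorphXn /= -rnormE.
    by rewrite normrX normr_id.
  rewrite {2}/g linear_sumlz /= -lecR -normcE rmorph_sum /=.
  apply: le_trans (ler_norm_sum _ _ _) _; apply: ler_sum => k _.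
  rewrite linearZl_LR /= normrM !normcE -rmorphM /=.
  by rewrite [normc (ip g _)]normc_ipC.
have gB : \sum_(i <= k < n) normc (ip g (phi k)) ^+ 2 <= B * rnorm g ^+ 2.
  have [lein|ltni] := leqP i n; last first.
    by rewrite big_geq ?(ltnW ltni)// mulr_ge0 ?sqr_ge0 ?(ltW B0).
  apply: le_trans (_ : \sum_(0 <= k < n) normc (ip g (phi k)) ^+ 2 <= _).
    rewrite [leRHS](@big_cat_nat _ _ _ i)//= lerDr sumr_ge0// => k _.
    exact: sqr_ge0.
  rewrite -lee_fin (le_trans _ (phiB g))// -sumEFin.
  by apply: nneseries_lim_ge => k _ _; rewrite lee_fin sqr_ge0.
have : 2 * \sum_(i <= k < n) normc (c k) * normc (ip g (phi k)) <=
    B * (\sum_(i <= k < n) normc (c k) ^+ 2) +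
    B^-1 * \sum_(i <= k < n) normc (ip g (phi k)) ^+ 2.
  rewrite !mulr_sumr -big_split /=; apply: ler_sum => k _.
  set a := normc _; set b := normc _; rewrite -subr_ge0.
  have -> : B * a ^+ 2 + B^-1 * b ^+ 2 - 2 * (a * b) = B^-1 * (B * a - b) ^+ 2.
    by field; rewrite gt_eqF.
  by rewrite mulr_ge0 ?sqr_ge0// invr_ge0 ltW.
(* Together these bounds give twice [rnorm g ^+ 2] on the left against one on the right, and one
   copy cancels. *)
have : B^-1 * \sum_(i <= k < n) normc (ip g (phi k)) ^+ 2 <= rnorm g ^+ 2.
  by rewrite ler_pdivrMl.
lra.
Qed.

(** Shows that the [limn] in [synthesis] is a true limit: by [bessel_sum_le], a block of the series
    is controlled by the square root of [B] times the tail of [c]. *)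
Lemma synthesis_cvg (phi : nat -> H) : bessel ip phi -> forall c : ell2 R,
  series (fun n => c n *: phi n) @ \oo --> synthesis phi c.
Proof.
move=> [B B0 phiB] c.
pose tail i := B * (ell2norm c ^+ 2 - \sum_(0 <= k < i) normc (c k) ^+ 2).
suff : cvgn (series (fun n => c n *: phi n)) by [].
apply: (@cauchy_tail_cvgn _ _ _ (Num.sqrt \o tail)).
  rewrite -sqrtr0; apply: continuous_cvg; first exact: sqrt_continuous.
  rewrite -(mulr0 B) -(subrr (ell2norm c ^+ 2)).
  apply: cvgM; first exact: cvg_cst.
  by apply: cvgB; [exact: cvg_cst|exact: sqsum_partial_cvg].
move=> i n lein; rewrite sub_series lein /=.
rewrite -(ger0_norm (rnorm_ge0 _)) -sqrtr_sqr ler_wsqrtr//.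
apply: le_trans (bessel_sum_le _ _ _ B0 phiB) _.
by rewrite ler_wpM2l ?(ltW B0)// sqsum_partial_le.
Qed.

Lemma synthesis_bounded (phi : nat -> H) :
  bessel ip phi -> bounded_op (synthesis phi : ell2 R -> H).
Proof.
move=> phiB; split=> [a c d|].
  apply: (cvg_lim (@norm_hausdorff _ H)).
  have -> : series (fun n => (a *: c + d) n *: phi n) =
      a \*: series (fun n => c n *: phi n) + series (fun n => d n *: phi n).
    apply/funext => n; rewrite fctE /series /= scaler_sumr -big_split.
    by apply: eq_bigr => k _; rewrite /= scalerA; exact: scalerDl.
  by apply: cvgD; [apply: cvgZl_tmp|]; exact: synthesis_cvg.
have [B B0 phiBB] := phiB.
exists (Num.sqrt B) => c; apply: (rnorm_lim_le (@synthesis_cvg _ phiB c)) => n.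
rewrite -(ger0_norm (rnorm_ge0 _)) -sqrtr_sqr.
have -> : rnorm c = ell2norm c by [].
rewrite -[ell2norm c]ger0_norm ?ell2norm_ge0// -sqrtr_sqr -sqrtrM ?(ltW B0)//.
rewrite ler_wsqrtr// (le_trans (bessel_sum_le _ _ _ B0 phiBB))//.
rewrite ler_wpM2l ?(ltW B0)// (le_trans (sqsum_partial_le c (leq0n n)))//.
by rewrite big_geq// subr0.
Qed.

Lemma analysis_bounded (psi : nat -> H) (psiB : bessel ip psi) :
  bounded_op (analysis psiB).
Proof.
split=> [a f g|].
  apply: val_inj; apply/funext => n /=.
  by rewrite linearPl.
have [B B0 psiBB] := psiB.
exists (Num.sqrt B) => f.
have -> : rnorm (analysis psiB f) = ell2norm (analysis psiB f) by [].
rewrite -[rnorm f]ger0_norm ?rnorm_ge0// -sqrtr_sqr -sqrtrM ?(ltW B0)//.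
rewrite -[ell2norm _]ger0_norm ?ell2norm_ge0// -sqrtr_sqr ler_wsqrtr//.
by rewrite -lee_fin -sqsumE; exact: psiBB.
Qed.

Lemma linfty_norm_ub (m : nat -> R[i]) (mB : linfty m) n :
  normc (m n) <= linfty_norm m.
Proof.
apply: ub_le_sup; last by exists n.
have /pinfty_ex_gt0[K K0 mK] := mB.
exists (complex.Re K) => _ [k _ <-].
have : (`|m k| : R[i]) <= K by exact: mK.
by rewrite lecE => /andP[_].
Qed.

Lemma linfty_norm_ge0 (m : nat -> R[i]) (mB : linfty m) : 0 <= linfty_norm m.
Proof. exact: le_trans (normc_ge0 (m 0%N)) (linfty_norm_ub mB 0). Qed.

Lemma ell2norm_mulop_le (m : nat -> R[i]) (mB : linfty m) (c : ell2 R) :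
  ell2norm (mulop mB c) <= linfty_norm m * ell2norm c.
Proof.
have m0 := linfty_norm_ge0 mB.
rewrite -ler_sqr ?nnegrE ?mulr_ge0 ?ell2norm_ge0// -lee_fin -sqsumE.
rewrite exprMn EFinM -sqsumE /sqsum -nneseriesZl; last first.
  by move=> n _; rewrite lee_fin sqr_ge0.
apply: lee_nneseries => n _; first by rewrite lee_fin sqr_ge0.
rewrite -EFinM lee_fin ComplexField.Normc.normcM exprMn ler_wpM2r ?sqr_ge0//.
by rewrite ler_sqr ?nnegrE ?normc_ge0// linfty_norm_ub.
Qed.

Lemma mulop_bounded (m : nat -> R[i]) (mB : linfty m) : bounded_op (mulop mB).
Proof.
split=> [a c d|]; last by exists (linfty_norm m) => c; exact: ell2norm_mulop_le.
apply: val_inj; apply/funext => n /=.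
by rewrite [LHS]mulrDr [in LHS]mulrCA.
Qed.

End bessel_theory.

(** * The multiplier as a product of two bounded operators *)

Theorem theorem1p3 (R : realType) (H : completeNormedModType R[i])
    (ip : {dot H for conjC}) (ip_norm : forall f : H, ip f f = `|f| ^+ 2)
    (H_separable : separable H)
    (phi psi : nat -> H) (phiB : bessel ip phi) (psiB : bessel ip psi)
    (m : nat -> R[i]) (mB : linfty m) :
  let M := bessel_multiplier ip m phi psi in
  let G := cross_gram phi psiB in
  [/\ spectral_radius M = spectral_radius (mulop mB \o G),
      spectral_radius M <= linfty_norm m * opnorm G &
      spectrum M `<=` [set l : R[i] | normc l <= linfty_norm m * opnorm G]].
Proof.
(* [M] is convertible to [D \o A], and [mulop mB \o G] to [A \o D], so the results on products apply
   directly. *)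
move=> M G; pose A := mulop mB \o analysis psiB; pose D := @synthesis R H phi.
have Db : bounded_op (D : ell2 R -> H) := synthesis_bounded ip_norm phiB.
have Cb := analysis_bounded psiB.
have Ab : bounded_op A := bounded_op_comp Cb (mulop_bounded mB).
have Gb : bounded_op G := bounded_op_comp Db Cb.
have Mb : bounded_op (D \o A) := bounded_op_comp Ab Db.
have [G0 GK] := le_opnorm Gb.
have m0 := linfty_norm_ge0 mB.
pose q := linfty_norm m * opnorm G.
have q0 : 0 <= q by rewrite mulr_ge0.
have TK c : rnorm (A (D c)) <= q * rnorm c.
  apply: le_trans (ell2norm_mulop_le mB _) _.
  by rewrite -mulrA ler_wpM2l//; exact: GK.
have spM l : spectrum M l -> normc l <= q.
  exact: (spectrum_comp_le Ab Db q0 TK).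
split=> //; first exact: (spectral_radius_comp Ab Db).
rewrite /spectral_radius.
(* [sup_le_ub] asks for a nonempty set; for an empty spectrum, as on the zero space, the [sup] is
   [0] and [q0] concludes. *)
have [->|/set0P[l sl]] := eqVneq (spectrum M) set0.
  by rewrite image_set0 sup0.
apply: sup_le_ub; first by exists (normc l), l.
by move=> _ [k /spM kq <-].
Qed.
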